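(* Let $d\ge 2$ be an integer. There exists an extreme point of the set $\mathcal{CP}\!\left[\mathbb{M}_d,\mathbb{M}_{d+1};\frac{I_d}{d},\frac{I_{d+1}}{d+1}\right]$ with Choi-rank $d+1$.
   Context: $\mathbb{M}_n$ is the algebra of complex $n\times n$ matrices with identity $I_n$. A linear map $\Phi:\mathbb{M}_{d_1}\to\mathbb{M}_{d_2}$ is completely positive (CP) if and only if $\Phi(X)=\sum_{j=1}^r V_j^*XV_j$ for some complex $d_1\times d_2$ matrices $V_j$; the smallest possible $r$ is the Choi-rank of $\Phi$. $\Phi^*:\mathbb{M}_{d_2}\to\mathbb{M}_{d_1}$ is the dual map defined by $\mathrm{tr}(\Phi(X)^*Y)=\mathrm{tr}(X^*\Phi^*(Y))$. For $A_1\in\mathbb{M}_{d_1}$, $A_2\in\mathbb{M}_{d_2}$, $\mathcal{CP}[\mathbb{M}_{d_1},\mathbb{M}_{d_2};A_1,A_2]$ is the convex set of all CP maps $\Phi:\mathbb{M}_{d_1}\to\mathbb{M}_{d_2}$ with $\Phi(I_{d_1})=A_2$ and $\Phi^*(I_{d_2})=A_1$. *)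

(* Defs.v *)
From HB Require Import structures.
From mathcomp Require Import all_boot all_order all_algebra.
From mathcomp Require Import spectral.
From mathcomp Require Import all_classical reals complex.

Set Implicit Arguments.
Unset Strict Implicit.
Unset Printing Implicit Defensive.

Import Order.TTheory GRing.Theory Num.Theory.

Local Open Scope ring_scope.
Local Open Scope complex_scope.
Local Open Scope sesquilinear_scope.
Local Open Scope classical_set_scope.

Section CPMaps.
Variable R : realType.
Local Notation C := R[i].

(* Linear maps M_d1 -> M_d2, as a complex vector space. *)
Definition linmap (d1 d2 : nat) := 'Hom('M[C]_d1, 'M[C]_d2).

Definition kraus (d1 d2 r : nat) (Phi : linmap d1 d2)
    (V : 'I_r -> 'M[C]_(d1, d2)) : Prop :=
  forall X, Phi X = \sum_(j < r) (V j)^t* *m X *m V j.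

Definition completely_positive d1 d2 (Phi : linmap d1 d2) : Prop :=
  exists r, exists V : 'I_r -> 'M[C]_(d1, d2), kraus Phi V.

(* [Phi] has Choi-rank [r]; never satisfied when [Phi] is not CP. *)
Definition has_choi_rank d1 d2 (Phi : linmap d1 d2) (r : nat) : Prop :=
  (exists V : 'I_r -> 'M[C]_(d1, d2), kraus Phi V) /\
  (forall s (W : 'I_s -> 'M[C]_(d1, d2)), kraus Phi W -> (r <= s)%N).

(* The entry (i, j) of the dual is forced by testing the defining identity
   tr (Phi(X)^* Y) = tr (X^* Phi^*(Y)) on X = delta_mx i j; see [dual_mapP]
   and [dual_map_uniq]. *)
Definition dual_fun d1 d2 (Phi : linmap d1 d2) (Y : 'M[C]_d2) : 'M[C]_d1 :=
  \matrix_(i, j) \tr ((Phi (delta_mx i j))^t* *m Y).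

Lemma dual_fun_is_linear d1 d2 (Phi : linmap d1 d2) : linear (dual_fun Phi).
Proof.
move=> a Y Z; apply/matrixP => i j; rewrite !mxE.
by rewrite mulmxDr -scalemxAr mxtraceD mxtraceZ.
Qed.

HB.instance Definition _ d1 d2 (Phi : linmap d1 d2) :=
  GRing.isLinear.Build C 'M[C]_d2 'M[C]_d1 _ (dual_fun Phi)
    (dual_fun_is_linear Phi).

Definition dual_map d1 d2 (Phi : linmap d1 d2) : linmap d2 d1 :=
  linfun (dual_fun Phi).

Lemma mxtrace_adjE d (X Z : 'M[C]_d) :
  \tr (X^t* *m Z) = \sum_i \sum_j Num.conj (X i j) * Z i j.
Proof.
rewrite /mxtrace exchange_big /=; apply: eq_bigr => j _.
by rewrite mxE; apply: eq_bigr => i _; rewrite !mxE.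
Qed.

Lemma dual_mapP d1 d2 (Phi : linmap d1 d2) X Y :
  \tr ((Phi X)^t* *m Y) = \tr (X^t* *m dual_map Phi Y).
Proof.
rewrite [RHS]mxtrace_adjE [in LHS](matrix_sum_delta X) linear_sum.
rewrite linear_sum /= map_mx_sum mulmx_suml raddf_sum /=.
apply: eq_bigr => i _.
rewrite linear_sum linear_sum /= map_mx_sum mulmx_suml raddf_sum /=.
apply: eq_bigr => j _.
by rewrite lfunE /= mxE !linearZ /= map_mxZ -scalemxAl mxtraceZ.
Qed.

Lemma dual_map_uniq d1 d2 (Phi : linmap d1 d2) (Psi : linmap d2 d1) :
  (forall X Y, \tr ((Phi X)^t* *m Y) = \tr (X^t* *m Psi Y)) ->
  Psi = dual_map Phi.
Proof.
move=> H; apply/lfunP => Y; rewrite lfunE; apply/matrixP => i j.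
rewrite mxE H mxtrace_adjE (bigD1 i) //= (bigD1 j) //= !mxE !eqxx conjC1 mul1r.
rewrite big1 => [|k /negPf nk]; last by rewrite !mxE nk andbF conjC0 mul0r.
rewrite addr0 big1 ?addr0 // => k /negPf nk.
by rewrite big1 // => l _; rewrite !mxE nk conjC0 mul0r.
Qed.

Definition CP d1 d2 (A1 : 'M[C]_d1) (A2 : 'M[C]_d2) : set (linmap d1 d2) :=
  [set Phi | [/\ completely_positive Phi,
                 Phi 1%:M = A2 & dual_map Phi 1%:M = A1]].

Definition extreme_point (E : lmodType C) (S : set E) (x : E) : Prop :=
  S x /\
  forall (y z : E) (t : R), S y -> S z -> 0 < t < 1 ->
    x = t%:C *: y + (1 - t)%:C *: z -> y = x /\ z = x.

End CPMaps.

(* Main.v *)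
(** By Choi's criterion, a CP map with Kraus operators V_0, ..., V_(r-1) whose
    r^2 products V_i^* V_j are linearly independent has Choi-rank r and is
    extreme among the CP maps with the same value at the identity: a map
    occurring in a convex decomposition has its Kraus operators in the span of
    the V_j (its Choi form vanishes where that of Phi does), so it is
    X |-> sum_(i,j) g_ij V_i^* X V_j, and the value at the identity forces
    g = 1.

    Index C^(d+1) by Z/(d+1), index C^d by the nonzero h in Z/(d+1), and take
    V_j = s sum_(h <> 0) |h><j + h|, with
    s^2 = 1/(d(d+1)). If sum_(i,j) G_ij V_i^* V_j = 0 then
    sum_(h <> 0) G(a - h, b - h) = 0 for all a, b, hence
    sum_h G(a - h, b - h) = G(a, b). The left-hand side is invariant under
    diagonal shifts, so G is too, and (d + 1) G = G, i.e. G = 0. *)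

Require Import Defs.
From HB Require Import structures.
From mathcomp Require Import all_boot all_order all_algebra.
From mathcomp Require Import spectral.
From mathcomp Require Import all_classical reals complex.
From mathcomp Require Import ring.

Set Implicit Arguments.
Unset Strict Implicit.
Unset Printing Implicit Defensive.

Import Order.TTheory GRing.Theory Num.Theory.

Local Open Scope ring_scope.

Lemma mxtrace_mxvec (F : comNzRingType) m n (A B : 'M[F]_(m, n)) :
  \tr (A *m B^T) = (mxvec A *m (mxvec B)^T) 0 0.
Proof.
transitivity (\sum_i \sum_j A i j * B i j).
  by apply: eq_bigr => i _; rewrite !mxE; apply: eq_bigr => j _; rewrite mxE.
rewrite pair_bigA [RHS]mxE (reindex _ (curry_mxvec_bij _ _)) /=.
by apply: eq_bigr => -[i j] _; rewrite mxE !mxvecE.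
Qed.

Lemma sum_scalar1_mx (F : nzRingType) (E : lmodType F) r
    (M : 'I_r -> 'I_r -> E) :
  \sum_i \sum_j (1%:M : 'M[F]_r) i j *: M i j = \sum_i M i i.
Proof.
apply: eq_bigr => i _; rewrite (bigD1 i) //= mxE eqxx scale1r.
by rewrite big1 ?addr0 // => j /negPf nj; rewrite mxE eq_sym nj scale0r.
Qed.

(** * Kraus families, the Choi form and Choi's criterion *)

Section Choi.
Local Open Scope complex_scope.
Local Open Scope sesquilinear_scope.
Variable R : realType.
Local Notation C := R[i].
Variables d1 d2 : nat.
Implicit Types (Phi Psi : linmap R d1 d2) (Y : 'M[C]_(d2, d1)).

Lemma adjmxM m n p (A : 'M[C]_(m, n)) (B : 'M[C]_(n, p)) :
  (A *m B)^t* = B^t* *m A^t*.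
Proof. by rewrite trmx_mul map_mxM. Qed.

Lemma adjmxK m n (A : 'M[C]_(m, n)) : (A^t*)^t* = A.
Proof. by apply/matrixP => i j; rewrite !mxE conjCK. Qed.

Lemma adjmxZ m n a (A : 'M[C]_(m, n)) : (a *: A)^t* = a^* *: A^t*.
Proof. by rewrite linearZ /= map_mxZ. Qed.

Definition kraus_fun r (V : 'I_r -> 'M[C]_(d1, d2)) (X : 'M[C]_d1) : 'M[C]_d2 :=
  \sum_(j < r) (V j)^t* *m X *m V j.

Lemma kraus_fun_is_linear r (V : 'I_r -> 'M[C]_(d1, d2)) : linear (kraus_fun V).
Proof.
move=> a X Y; rewrite /kraus_fun scaler_sumr -big_split /=.
apply: eq_bigr => j _.
by rewrite mulmxDr mulmxDl -scalemxAr -scalemxAl.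
Qed.

HB.instance Definition _ r (V : 'I_r -> 'M[C]_(d1, d2)) :=
  GRing.isLinear.Build C 'M[C]_d1 'M[C]_d2 _ (kraus_fun V)
    (kraus_fun_is_linear V).

Lemma kraus_linfun r (V : 'I_r -> 'M[C]_(d1, d2)) :
  kraus (linfun (kraus_fun V)) V.
Proof. by move=> X; rewrite lfunE. Qed.

Lemma dual_map_kraus1 r Phi (V : 'I_r -> 'M[C]_(d1, d2)) :
  kraus Phi V -> dual_map Phi 1%:M = \sum_(j < r) V j *m (V j)^t*.
Proof.
move=> PV; rewrite lfunE; apply/matrixP => k l.
rewrite mxE mulmx1 PV summxE linear_sum map_mx_sum raddf_sum /=.
apply: eq_bigr => j _.
rewrite !adjmxM adjmxK mxtrace_mulC -mulmxA mxtrace_mulC.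
rewrite trmx_delta map_delta_mx -(mul_delta_mx (0 : 'I_1)) mulmxA.
by rewrite mxtrace_mulC mulmxA -colE -rowE trace_mx11 !mxE.
Qed.

(* The quadratic form of the Choi matrix: unlike a Kraus family, it is
   determined by [Phi] and linear in it. *)
Definition choi_form Phi Y : C :=
  \sum_k \sum_l ((col k Y)^t* *m Phi (delta_mx k l) *m col l Y) 0 0.

Lemma choi_form_kraus r Phi (V : 'I_r -> 'M[C]_(d1, d2)) Y :
  kraus Phi V -> choi_form Phi Y = \sum_(j < r) `|\tr (V j *m Y)| ^+ 2.
Proof.
move=> PV; rewrite /choi_form.
under eq_bigr do under eq_bigr do
  rewrite PV mulmx_sumr mulmx_suml summxE.
under eq_bigr do rewrite exchange_big /=.
rewrite exchange_big /=; apply: eq_bigr => j _.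
rewrite normCK mulrC {1}/mxtrace rmorph_sum mulr_suml; apply: eq_bigr => k _.
rewrite /mxtrace mulr_sumr; apply: eq_bigr => l _.
set U := V j *m Y.
(* Factoring the matrix unit through a one-dimensional space splits the summand into the conjugate
   of [U k k] times [U l l], as in the expanded square of the trace. *)
have -> : (col k Y)^t* *m ((V j)^t* *m delta_mx k l *m V j) *m col l Y
    = ((col k U)^t* *m delta_mx k 0) *m (delta_mx (0 : 'I_1) l *m col l U).
  rewrite /U !colE !adjmxM -!mulmxA; congr (_ *m (_ *m (_ *m _))).
  by rewrite !mulmxA mul_delta_mx.
by rewrite -colE -rowE mxE big_ord1 !mxE.
Qed.

Lemma choi_form_eq0 r Phi (V : 'I_r -> 'M[C]_(d1, d2)) Y :
  kraus Phi V -> (choi_form Phi Y = 0 <-> forall j, \tr (V j *m Y) = 0).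
Proof.
move=> PV; rewrite (choi_form_kraus _ PV); split=> [|V0]; last first.
  by rewrite big1 // => j _; rewrite V0 normr0 expr0n.
move/eqP; rewrite psumr_eq0 => [/allP V0 j|? _]; last by rewrite exprn_ge0.
by have := V0 j (mem_index_enum j); rewrite expf_eq0 normr_eq0 => /eqP.
Qed.

Definition kraus_mx r (V : 'I_r -> 'M[C]_(d1, d2)) : 'M[C]_(r, d1 * d2) :=
  \matrix_j mxvec (V j).

(** Duality for the trace pairing: each column of the cokernel of [kraus_mx V], reshaped into a
    matrix [Y], is orthogonal to all [V j], hence to all [W i], so that cokernel also kills
    [kraus_mx W]. *)
Lemma kraus_mx_sub r s (V : 'I_r -> 'M[C]_(d1, d2))
    (W : 'I_s -> 'M[C]_(d1, d2)) :
  (forall Y, (forall j, \tr (V j *m Y) = 0) -> forall i, \tr (W i *m Y) = 0) ->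
  (kraus_mx W <= kraus_mx V)%MS.
Proof.
move=> VW; rewrite submxE; apply/eqP/matrixP => i k.
pose y := col k (cokermx (kraus_mx V)).
have trE t (U : 'I_t -> 'M[C]_(d1, d2)) j :
    \tr (U j *m (vec_mx y^T)^T) = (kraus_mx U *m y) j 0.
  rewrite mxtrace_mxvec vec_mxK trmxK.
  by rewrite -[mxvec _](rowK (fun i => mxvec (U i))) -row_mul mxE.
have VY j : \tr (V j *m (vec_mx y^T)^T) = 0.
  by rewrite trE /y colE mulmxA mulmx_coker mul0mx mxE.
have := VW _ VY i; rewrite trE /y colE mulmxA -colE mxE => ->.
by rewrite mxE.
Qed.

Lemma kraus_mx_subP r s (V : 'I_r -> 'M[C]_(d1, d2))
    (W : 'I_s -> 'M[C]_(d1, d2)) :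
  (kraus_mx W <= kraus_mx V)%MS ->
  exists D : 'M[C]_(s, r), forall m, W m = \sum_j D m j *: V j.
Proof.
case/submxP => D WD; exists D => m; apply: (can_inj mxvecK).
rewrite linear_sum -[LHS](rowK (fun i => mxvec (W i))) -/(kraus_mx W) WD.
rewrite row_mul mulmx_sum_row; apply: eq_bigr => j _.
by rewrite rowK mxE linearZ.
Qed.

(** The coefficient matrix [D^t* *m D] does not depend on [X], so what is learnt about it at the
    identity holds for the whole map. *)
Lemma kraus_fun_comb r s (V : 'I_r -> 'M[C]_(d1, d2))
    (W : 'I_s -> 'M[C]_(d1, d2)) (D : 'M[C]_(s, r)) X :
  (forall m, W m = \sum_j D m j *: V j) ->
  kraus_fun W X =
    \sum_i \sum_j (D^t* *m D) i j *: ((V i)^t* *m X *m V j).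
Proof.
move=> WD; rewrite /kraus_fun.
under [RHS]eq_bigr do under eq_bigr do rewrite mxE scaler_suml.
under [RHS]eq_bigr do rewrite exchange_big /=.
rewrite [RHS]exchange_big /=; apply: eq_bigr => m _.
rewrite {1}WD linear_sum map_mx_sum !mulmx_suml; apply: eq_bigr => i _.
rewrite WD mulmx_sumr; apply: eq_bigr => j _.
by rewrite adjmxZ -!scalemxAl -scalemxAr scalerA !mxE.
Qed.

Definition free_products r (V : 'I_r -> 'M[C]_(d1, d2)) : Prop :=
  forall G : 'M[C]_r,
    \sum_i \sum_j G i j *: ((V i)^t* *m V j) = 0 -> G = 0.

(** A relation with coefficients v among the [V j] yields the rank-one relation [v^t* *m v] among
    the products, whose diagonal entries are the squared moduli of the coefficients. *)
Lemma free_products_row_free r (V : 'I_r -> 'M[C]_(d1, d2)) :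
  free_products V -> row_free (kraus_mx V).
Proof.
move=> freeV; apply: inj_row_free => v vV0.
have V0 : \sum_j v 0 j *: V j = 0.
  apply: (can_inj mxvecK); rewrite [RHS]linear0 -vV0 mulmx_sum_row linear_sum.
  by apply: eq_bigr => j _; rewrite rowK linearZ.
have /freeV/matrixP G0 :
    \sum_i \sum_j (v^t* *m v) i j *: ((V i)^t* *m V j) = 0.
  rewrite [LHS](_ : _ = \sum_i (v 0 i)^* *: ((V i)^t* *m \sum_j v 0 j *: V j)).
    by rewrite V0 big1 // => i _; rewrite mulmx0 scaler0.
  apply: eq_bigr => i _; rewrite mulmx_sumr scaler_sumr; apply: eq_bigr => j _.
  by rewrite mxE big_ord1 !mxE -scalemxAr scalerA.
apply/rowP => j; have := G0 j j; rewrite mxE big_ord1 !mxE => /eqP.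
by rewrite mulf_eq0 conjC_eq0 orbb => /eqP.
Qed.

Lemma choi_criterion_uniq r Phi Psi Th (V : 'I_r -> 'M[C]_(d1, d2)) (t : R) :
  kraus Phi V -> free_products V ->
  completely_positive Psi -> completely_positive Th -> 0 < t < 1 ->
  Psi 1%:M = Phi 1%:M -> Phi = t%:C *: Psi + (1 - t)%:C *: Th -> Psi = Phi.
Proof.
move=> PV freeV [s [W PW]] [u [Z PZ]] /andP[t0 t1] Psi1 Phi_conv.
have choi_conv Y : choi_form Phi Y =
    t%:C * choi_form Psi Y + (1 - t)%:C * choi_form Th Y.
  rewrite Phi_conv /choi_form !mulr_sumr -big_split; apply: eq_bigr => k _ /=.
  rewrite !mulr_sumr -big_split; apply: eq_bigr => l _ /=.
  rewrite add_lfunE !scale_lfunE mulmxDr mulmxDl.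
  by rewrite -!scalemxAr -!scalemxAl !mxE.
have choi_ge0 n (U : 'I_n -> 'M[C]_(d1, d2)) Xi Y :
    kraus Xi U -> 0 <= choi_form Xi Y.
  move=> XU; rewrite (choi_form_kraus _ XU).
  by apply: sumr_ge0 => j _; rewrite exprn_ge0.
have [|D WD] := @kraus_mx_subP r s V W.
  apply: kraus_mx_sub => Y VY i.
  (* Two nonnegative terms add up to 0, so each vanishes; since t is nonzero, so does the Choi form
     of [Psi]. *)
  have /esym/eqP := choi_conv Y; move/(choi_form_eq0 _ PV): VY => ->.
  rewrite paddr_eq0; last 2 first.
  - by apply: mulr_ge0; [rewrite lecR ltW | apply: choi_ge0 PW].
  - by apply: mulr_ge0; [rewrite lecR subr_ge0 ltW | apply: choi_ge0 PZ].
  rewrite mulf_eq0 -[0]/(0%:C) (inj_eq (@complexI _)) gt_eqF //=.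
  by case/andP=> /eqP /(choi_form_eq0 _ PW).
have PsiE X : Psi X = \sum_i \sum_j (D^t* *m D) i j *: ((V i)^t* *m X *m V j).
  by rewrite PW -(kraus_fun_comb _ WD).
have PhiE X :
    Phi X = \sum_i \sum_j (1%:M : 'M_r) i j *: ((V i)^t* *m X *m V j).
  by rewrite PV sum_scalar1_mx.
suff /eqP D1 : D^t* *m D - 1%:M == 0.
  by apply/lfunP => X; rewrite PsiE PhiE; move/subr0_eq: D1 => ->.
(* At the identity, the difference of the two expansions is a linear relation among the products of
   the [V i]. *)
apply/eqP/freeV; rewrite -[RHS](subrr (Phi 1%:M)) -{1}Psi1 PsiE PhiE -sumrB.
apply: eq_bigr => i _; rewrite -sumrB; apply: eq_bigr => j _.
by rewrite mulmx1 -scalerBl [in LHS]mxE [X in _ + X]mxE.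
Qed.

Lemma choi_criterion r Phi (V : 'I_r -> 'M[C]_(d1, d2)) A1 A2 :
  kraus Phi V -> free_products V -> CP A1 A2 Phi ->
  extreme_point (CP A1 A2) Phi.
Proof.
move=> PV freeV CPPhi; split=> // Psi Th t [cpPsi Psi1 _] [cpTh Th1 _] t01 PhiE.
have [_ Phi1 _] := CPPhi.
rewrite -Phi1 in Psi1 Th1.
split; first exact: choi_criterion_uniq PV freeV cpPsi cpTh t01 Psi1 PhiE.
have s01 : 0 < 1 - t < 1 by rewrite subr_gt0 gtrBl andbC.
have PhiE' : Phi = (1 - t)%:C *: Th + (1 - (1 - t))%:C *: Psi.
  by rewrite subKr addrC; exact: PhiE.
exact: choi_criterion_uniq PV freeV cpTh cpPsi s01 Th1 PhiE'.
Qed.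

(** The zeros of the Choi form depend on [Phi] alone, so any Kraus family [W] spans a space
    containing the r independent operators [V j]. *)
Lemma free_products_choi_rank r Phi (V : 'I_r -> 'M[C]_(d1, d2)) :
  kraus Phi V -> free_products V -> has_choi_rank Phi r.
Proof.
move=> PV freeV; split=> [|s W PW]; first by exists V.
have /mxrankS : (kraus_mx V <= kraus_mx W)%MS.
  by apply: kraus_mx_sub => Y /(choi_form_eq0 _ PW) /(choi_form_eq0 _ PV).
rewrite (eqP (free_products_row_free freeV)) => /leq_trans -> //.
exact: rank_leq_row.
Qed.

End Choi.

(** * The shift operators and their products *)

Section Shift.
Local Open Scope complex_scope.
Local Open Scope sesquilinear_scope.
Variables (R : realType) (d : nat).
Local Notation C := R[i].

Let scale : C := (sqrtC (d * d.+1)%:R)^-1.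

(** Addition in ['I_d.+1] is modulo d + 1, and [lift ord0 k] runs over its nonzero elements. *)
Definition shift_op (j : 'I_d.+1) : 'M[C]_(d, d.+1) :=
  \matrix_(k, a) (scale * (a == j + lift ord0 k)%:R).

Lemma conj_scaleM : scale^* * scale = (d * d.+1)%:R^-1.
Proof.
have sc_real : scale \is Num.real.
  by rewrite ger0_real ?invr_ge0 ?sqrtC_ge0 ?ler0n.
by rewrite (CrealP sc_real) -expr2 exprVn sqrtCK.
Qed.

Lemma sum_indicator (F : 'I_d.+1 -> C) x : \sum_i F i * (i == x)%:R = F x.
Proof.
rewrite (bigD1 x) //= eqxx mulr1 big1 ?addr0 // => i /negPf ->.
by rewrite mulr0.
Qed.

Lemma sum_shift (F : 'I_d.+1 -> C) a h :
  \sum_i F i * (a == i + h)%:R = F (a - h).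
Proof.
rewrite -[RHS]sum_indicator; apply: eq_bigr => i _.
by rewrite [i == _]eq_sym subr_eq.
Qed.

(** For each nonzero shift h, only the pair i = a - h, j = b - h contributes to the entry (a, b). *)
Lemma shift_op_gram (G : 'M[C]_d.+1) a b :
  (\sum_i \sum_j G i j *: ((shift_op i)^t* *m shift_op j)) a b =
  (d * d.+1)%:R^-1 * \sum_k G (a - lift ord0 k) (b - lift ord0 k).
Proof.
transitivity (\sum_k \sum_i \sum_j (d * d.+1)%:R^-1 * (G i j *
    (b == j + lift ord0 k)%:R * (a == i + lift ord0 k)%:R)).
  rewrite [RHS]exchange_big summxE; apply: eq_bigr => i _.
  rewrite [RHS]exchange_big summxE; apply: eq_bigr => j _.
  rewrite !mxE mulr_sumr; apply: eq_bigr => k _.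
  rewrite !mxE rmorphM rmorph_nat -conj_scaleM; ring.
rewrite mulr_sumr; apply: eq_bigr => k _.
under eq_bigr do rewrite -mulr_sumr -mulr_suml sum_shift.
by rewrite -mulr_sumr sum_shift.
Qed.

Lemma shift_op_free : (0 < d)%N -> free_products shift_op.
Proof.
move=> d_gt0 G G0; apply/matrixP => a b; rewrite mxE.
have natn0 n : (0 < n)%N -> n%:R != 0 :> C by rewrite pnatr_eq0 -lt0n.
(* The vanishing sum over nonzero h, completed by the term h = 0. *)
have sumG a' b' : \sum_h G (a' - h) (b' - h) = G a' b'.
  have /matrixP/(_ a' b')/eqP := G0; rewrite shift_op_gram mxE mulf_eq0 invr_eq0.
  rewrite (negPf (natn0 _ _)) ?muln_gt0 ?d_gt0 //= => /eqP sum0.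
  by rewrite big_ord_recl sum0 !subr0 addr0.
have invG h : G (a - h) (b - h) = G a b.
  rewrite -[RHS]sumG -[LHS]sumG [RHS](reindex_inj (addrI h)) /=.
  by apply: eq_bigr => k _; rewrite !opprD !addrA.
have /eqP := sumG a b; under eq_bigr do rewrite invG.
rewrite sumr_const card_ord mulrS -subr_eq0 addrAC subrr add0r.
by rewrite -mulr_natr mulf_eq0 (negPf (natn0 _ d_gt0)) orbF => /eqP.
Qed.

Lemma shift_op_unital : (0 < d)%N ->
  \sum_j (shift_op j)^t* *m shift_op j = (d.+1%:R^-1)%:M.
Proof.
move=> d_gt0; apply/matrixP => a b.
(* This is the Gram formula at G = 1: the d shifts each contribute 1 when a = b and 0 otherwise. *)
rewrite -(sum_scalar1_mx (fun i j => (shift_op i)^t* *m shift_op j)).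
rewrite shift_op_gram mxE.
under eq_bigr do rewrite mxE (inj_eq (addIr _)).
rewrite sumr_const card_ord natrM -mulr_natr -mulr_natl.
by field; rewrite nat1r !pnatr_eq0 -!lt0n d_gt0.
Qed.

(** For fixed j the rows of [shift_op j] are multiples of distinct basis vectors, so each of the d +
    1 summands is the same scalar matrix. *)
Lemma shift_op_trace : (0 < d)%N ->
  \sum_j shift_op j *m (shift_op j)^t* = (d%:R^-1)%:M.
Proof.
move=> d_gt0; apply/matrixP => k l; rewrite summxE mxE.
transitivity (\sum_(j < d.+1) (d * d.+1)%:R^-1 * (k == l)%:R :> C).
  apply: eq_bigr => j _; rewrite mxE.
  under eq_bigr => a _ do
    rewrite !mxE rmorphM rmorph_nat mulrACA [_ * scale^*]mulrC conj_scaleM mulrA.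
  rewrite sum_indicator (inj_eq (addrI _)).
  by rewrite (inj_eq lift_inj) eq_sym.
rewrite sumr_const card_ord natrM -[LHS]mulr_natr -[RHS]mulr_natr.
by field; rewrite nat1r !pnatr_eq0 -!lt0n d_gt0.
Qed.

End Shift.

Theorem theorem5p8 (R : realType) (d : nat) (hd : (2 <= d)%N) :
  exists Phi : linmap R d d.+1,
    extreme_point
      (CP ((d%:R^-1 : R[i])%:M : 'M[R[i]]_d)
          ((d.+1%:R^-1 : R[i])%:M : 'M[R[i]]_d.+1)) Phi
    /\ has_choi_rank Phi d.+1.
Proof.
have d_gt0 : (0 < d)%N by exact: ltnW.
have freeV := @shift_op_free R d d_gt0.
have kPhi := kraus_linfun (@shift_op R d).
exists (linfun (kraus_fun (@shift_op R d))).
split; last exact: free_products_choi_rank kPhi freeV.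
apply: (choi_criterion (kPhi) freeV); split.
- by exists d.+1, (@shift_op R d).
- rewrite kPhi -shift_op_unital //.
  by apply: eq_bigr => j _; rewrite mulmx1.
- by rewrite (dual_map_kraus1 kPhi) shift_op_trace.
Qed.
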